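(* Let $S$ be a regular ordered semigroup without zero element. Then the following conditions are equivalent: (1) $S$ is Clifford; (2) $\mathcal{L}=\mathcal{R}$; (3) $(aS]=(Sa]$ for all $a\in S$; (4) $(eS]=(Se]$ for all $e\in E_{\le}(S)$.
   Context: An ordered semigroup $(S,\cdot,\le)$ is a semigroup $(S,\cdot)$ that is a poset $(S,\le)$ such that $a\le b$ implies $ca\le cb$ and $ac\le bc$ for all $a,b,c\in S$. A zero element is an element $0$ with $0x=x0=0$ and $0\le x$ for all $x\in S$. For $H\subseteq S$, $(H]=\{t\in S: t\le h \text{ for some } h\in H\}$. $S$ is regular if $a\in(aSa]$ for every $a\in S$. The set of ordered idempotents is $E_{\le}(S)=\{e\in S: e\le e^2\}$. A regular ordered semigroup $S$ is Clifford if for all $a\in S$ and $e\in E_{\le}(S)$ there are $u,v\in S$ with $ae\le eua$ and $ea\le ave$. A nonempty $I\subseteq S$ is a left (right) ideal if $SI\subseteq I$ ($IS\subseteq I$) and $(I]\subseteq I$; $L(a)$ and $R(a)$ denote the smallest left and right ideals containing $a$. Green's relations: $a\,\mathcal{L}\,b$ iff $L(a)=L(b)$; $a\,\mathcal{R}\,b$ iff $R(a)=R(b)$. *)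

(* Defs.v *)
From HB Require Import structures.
From mathcomp Require Import all_boot all_order.
From mathcomp Require Import boolp classical_sets.

Set Implicit Arguments.
Unset Strict Implicit.
Unset Printing Implicit Defensive.

Local Open Scope classical_set_scope.
Local Open Scope order_scope.
Local Open Scope group_scope.

HB.mixin Record isOrderedSemigroup (d : Order.disp_t) S
    of Semigroup S & Order.POrder d S := {
  le_mulg2l : forall c a b : S, (a <= b)%O -> (c * a <= c * b)%O;
  le_mulg2r : forall c a b : S, (a <= b)%O -> (a * c <= b * c)%O
}.

#[short(type="orderedSemigroupType")]
HB.structure Definition OrderedSemigroup (d : Order.disp_t) :=
  { S of isOrderedSemigroup d S & Semigroup S & Order.POrder d S }.

Section OrderedSemigroupDefs.
Context {d : Order.disp_t} {S : orderedSemigroupType d}.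
Implicit Types (a b e : S) (H I : set S).

Definition is_zero (z : S) : Prop :=
  forall x : S, [/\ z * x = z, x * z = z & (z <= x)%O].

(* $(H]$ *)
Definition down_closure H : set S := [set t | exists2 h, H h & (t <= h)%O].

(* $aS$, $Sa$ and $aSa$ *)
Definition rmultiples a : set S := [set a * s | s in [set: S]].
Definition lmultiples a : set S := [set s * a | s in [set: S]].
Definition sandwich a : set S := [set a * s * a | s in [set: S]].

Definition ordered_idempotent : set S := [set e | (e <= e * e)%O].

Definition left_ideal I : Prop :=
  [/\ I !=set0, (forall s x, I x -> I (s * x)) & down_closure I `<=` I].

Definition right_ideal I : Prop :=
  [/\ I !=set0, (forall s x, I x -> I (x * s)) & down_closure I `<=` I].

Definition principal_left a : set S := smallest left_ideal [set a].
Definition principal_right a : set S := smallest right_ideal [set a].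

Definition greenL a b : Prop := principal_left a = principal_left b.
Definition greenR a b : Prop := principal_right a = principal_right b.

End OrderedSemigroupDefs.

Definition regular {d : Order.disp_t} (S : orderedSemigroupType d) : Prop :=
  forall a : S, down_closure (sandwich a) a.

Definition has_zero {d : Order.disp_t} (S : orderedSemigroupType d) : Prop :=
  exists z : S, is_zero z.

Definition clifford {d : Order.disp_t} (S : orderedSemigroupType d) : Prop :=
  regular S /\
  forall a e : S, ordered_idempotent e ->
    exists u v : S, (a * e <= e * u * a)%O /\ (e * a <= a * v * e)%O.

(* Main.v *)
Require Import Defs.
From mathcomp Require Import all_boot all_order.
From mathcomp Require Import boolp classical_sets.

(** Everything rests on regularity, which supplies for each [a] some [x] with
    [a <= a * x * a].  It makes [a] a member of (Sa] and of (aS], so these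
    sets are the principal ideals of [a], and it makes [a * x] and [x * a]
    ordered idempotents with [a <= (a * x) * a] and [a <= a * (x * a)].

    Clifford implies (aS] = (Sa]: in [s * a <= s * (a * x) * a] the ordered
    idempotent [a * x] moves to the left of [s], and the result starts with [a].
    If (aS] = (Sa] for all [a] then the principal left and right ideals
    coincide, whence L = R.

    L = R implies (aS] = (Sa]: put [b := a * s] and [b <= b * y * b].  The
    elements [b] and [y * b] are L-related, hence R-related, so
    [y * b <= b * r] for some [r], and [b <= b * b * r = (b * a) * (s * r)].
    Thus [b] and [b * a] are R-related, hence L-related, and [b] lies below a
    left multiple of [b * a], a fortiori of [a].  The case of [s * a] is dual.

    If (eS] = (Se] for ordered idempotents, the product [b := a * e] lies
    below an element of [eS], and also below one of [Sa], because
    [a * e <= a * ((x * a) * e)] and [(x * a) * e] lies below a left multiple of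
    [x * a].  Regularity, [b <= b * y * b], then glues the two bounds into one
    by an element of [eSa]. *)

Local Open Scope classical_set_scope.
Local Open Scope group_scope.

Section RegularOrderedSemigroup.
Context {d : Order.disp_t} {S : orderedSemigroupType d}.
Implicit Types (a b c e s x y : S).

Lemma le_mulg {a b c e : S} : (a <= b)%O -> (c <= e)%O -> (a * c <= b * e)%O.
Proof.
by move=> ab ce; apply: Order.POrderTheory.le_trans (le_mulg2l b _ _ ce);
  exact: le_mulg2r.
Qed.

Lemma down_lmultiplesP a t :
  down_closure (lmultiples a) t <-> exists s, (t <= s * a)%O.
Proof.
split=> [[_ [s _ <-] ts]|[s ts]]; first by exists s.
by exists (s * a) => //; exists s.
Qed.

Lemma down_rmultiplesP a t :
  down_closure (rmultiples a) t <-> exists s, (t <= a * s)%O.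
Proof.
split=> [[_ [s _ <-] ts]|[s ts]]; first by exists s.
by exists (a * s) => //; exists s.
Qed.

Lemma regularP : regular S -> forall a, exists x, (a <= a * x * a)%O.
Proof. by move=> Sreg a; have [_ [x _ <-] ax] := Sreg a; exists x. Qed.

Lemma ordered_idempotent_mulr a x :
  (a <= a * x * a)%O -> ordered_idempotent (a * x).
Proof. by move=> ax; rewrite /ordered_idempotent /= mulgA; exact: le_mulg2r. Qed.

Lemma ordered_idempotent_mull a x :
  (a <= a * x * a)%O -> ordered_idempotent (x * a).
Proof.
by move=> ax; rewrite /ordered_idempotent /= -mulgA (mulgA a); exact: le_mulg2l.
Qed.

Hypothesis Sreg : regular S.

Lemma principal_leftE a : principal_left a = down_closure (lmultiples a).
Proof.
have [x ax] := regularP Sreg a.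
rewrite eqEsubset; split=> [|t /down_lmultiplesP[s ts] I [[_ IM Idown] Ia]].
  have a_in : down_closure (lmultiples a) a.
    by apply/down_lmultiplesP; exists (a * x).
  apply: smallest_sub; last by move=> _ ->.
  split=> [|s t /down_lmultiplesP[r tr]|t [h /down_lmultiplesP[r hr] th]].
  - by exists a.
  - by apply/down_lmultiplesP; exists (s * r); rewrite -mulgA; exact: le_mulg2l.
  - apply/down_lmultiplesP; exists r.
    exact: Order.POrderTheory.le_trans th hr.
by apply: Idown; exists (s * a) => //; apply: IM; exact: Ia.
Qed.

Lemma principal_rightE a : principal_right a = down_closure (rmultiples a).
Proof.
have [x ax] := regularP Sreg a.
rewrite eqEsubset; split=> [|t /down_rmultiplesP[s ts] I [[_ IM Idown] Ia]].
  have a_in : down_closure (rmultiples a) a.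
    by apply/down_rmultiplesP; exists (x * a); rewrite mulgA.
  apply: smallest_sub; last by move=> _ ->.
  split=> [|s t /down_rmultiplesP[r tr]|t [h /down_rmultiplesP[r hr] th]].
  - by exists a.
  - by apply/down_rmultiplesP; exists (r * s); rewrite mulgA; exact: le_mulg2r.
  - apply/down_rmultiplesP; exists r.
    exact: Order.POrderTheory.le_trans th hr.
by apply: Idown; exists (a * s) => //; apply: IM; exact: Ia.
Qed.

Lemma greenLP a b :
  greenL a b <-> (exists s, (a <= s * b)%O) /\ (exists s, (b <= s * a)%O).
Proof.
rewrite /greenL !principal_leftE; split=> [Lab|[[s ab] [r ba]]].
  have [x ax] := regularP Sreg a; have [y bY] := regularP Sreg b.
  split; apply/down_lmultiplesP; [rewrite -Lab|rewrite Lab];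
    by apply/down_lmultiplesP; eexists; eassumption.
rewrite eqEsubset; split=> t /down_lmultiplesP[p tp]; apply/down_lmultiplesP.
- exists (p * s); rewrite -mulgA.
  by apply: Order.POrderTheory.le_trans tp _; exact: le_mulg2l.
- exists (p * r); rewrite -mulgA.
  by apply: Order.POrderTheory.le_trans tp _; exact: le_mulg2l.
Qed.

Lemma greenRP a b :
  greenR a b <-> (exists s, (a <= b * s)%O) /\ (exists s, (b <= a * s)%O).
Proof.
rewrite /greenR !principal_rightE; split=> [Rab|[[s ab] [r ba]]].
  have [x ax] := regularP Sreg a; have [y bY] := regularP Sreg b.
  rewrite -mulgA in ax; rewrite -mulgA in bY.
  split; apply/down_rmultiplesP; [rewrite -Rab|rewrite Rab];
    by apply/down_rmultiplesP; eexists; eassumption.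
rewrite eqEsubset; split=> t /down_rmultiplesP[p tp]; apply/down_rmultiplesP.
- exists (s * p); rewrite mulgA.
  by apply: Order.POrderTheory.le_trans tp _; exact: le_mulg2r.
- exists (r * p); rewrite mulgA.
  by apply: Order.POrderTheory.le_trans tp _; exact: le_mulg2r.
Qed.

(** Regularity creates, next to the factor [s] that has to be crossed, an
    ordered idempotent built from [a]; the Clifford condition moves it across. *)
Lemma clifford_multiples : clifford S ->
  forall a, down_closure (rmultiples a) = down_closure (lmultiples a).
Proof.
move=> [_ Scl] a; have [x ax] := regularP Sreg a.
rewrite eqEsubset; split=> t.
  move=> /down_rmultiplesP[s ts]; apply/down_lmultiplesP.
  have [_ [v [_ xas]]] := Scl s _ (ordered_idempotent_mull _ _ ax).
  exists (a * s * v * x); apply: Order.POrderTheory.le_trans ts _.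
  apply: Order.POrderTheory.le_trans (le_mulg2r s _ _ ax) _.
  by have := le_mulg2l a _ _ xas; rewrite !mulgA.
move=> /down_lmultiplesP[s ts]; apply/down_rmultiplesP.
have [u [_ [sax _]]] := Scl s _ (ordered_idempotent_mulr _ _ ax).
exists (x * u * s * a); apply: Order.POrderTheory.le_trans ts _.
apply: Order.POrderTheory.le_trans (le_mulg2l s _ _ ax) _.
by have := le_mulg2r a _ _ sax; rewrite !mulgA.
Qed.

Lemma multiples_greenLR :
  (forall a, down_closure (rmultiples a) = down_closure (lmultiples a)) ->
  @greenL d S = @greenR d S.
Proof.
move=> rl; apply/funext => a; apply/funext => b.
by rewrite /greenL /greenR !principal_leftE !principal_rightE !rl.
Qed.

(** The trick is that [b := a * s] lies below a multiple of [b * b], hence of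
    [b * a]; this makes [b] Green-equivalent to [b * a], which is a left
    multiple of [a]. *)
Lemma greenLR_multiples : @greenL d S = @greenR d S ->
  forall a, down_closure (rmultiples a) = down_closure (lmultiples a).
Proof.
move=> LR a; rewrite eqEsubset; split=> t.
  move=> /down_rmultiplesP[s ts]; apply/down_lmultiplesP.
  set b := a * s in ts; have [y bY] := regularP Sreg b.
  have : greenL (y * b) b.
    by apply/greenLP; split; [exists y | exists b; rewrite mulgA].
  rewrite LR => /greenRP[[r ybr] _].
  have : greenR b (b * a).
    apply/greenRP; split; last by exists a.
    exists (s * r); apply: Order.POrderTheory.le_trans bY _.
    by have := le_mulg2l b _ _ ybr; rewrite {4}/b !mulgA.
  rewrite -LR => /greenLP[[p bp] _].
  by exists (p * b); rewrite -mulgA; exact: Order.POrderTheory.le_trans ts bp.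
move=> /down_lmultiplesP[s ts]; apply/down_rmultiplesP.
set b := s * a in ts; have [y bY] := regularP Sreg b.
have : greenR (b * y) b.
  by apply/greenRP; split; [exists y | exists b].
rewrite -LR => /greenLP[[r byr] _].
have : greenL b (a * b).
  apply/greenLP; split; last by exists a.
  exists (r * s); apply: Order.POrderTheory.le_trans bY _.
  by have := le_mulg2r b _ _ byr; rewrite {4}/b !mulgA.
rewrite LR => /greenRP[[p bp] _].
by exists (b * p); rewrite mulgA; exact: Order.POrderTheory.le_trans ts bp.
Qed.

(** In [b <= b * y * b] the first [b] can be bounded by [e * s] and the last
    one by [r * a], independently of each other. *)
Lemma le_glue {b e s r a : S} :
  (b <= e * s)%O -> (b <= r * a)%O -> exists u, (b <= e * u * a)%O.
Proof.
move=> bes bra; have [y bY] := regularP Sreg b.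
exists (s * y * r); apply: Order.POrderTheory.le_trans bY _.
by have := le_mulg (le_mulg2r y _ _ bes) bra; rewrite !mulgA.
Qed.

(** The hypothesis bounds [a * e] by an element of [eS] directly, but by one of
    [Sa] only through the ordered idempotent [x * a], as [a] itself need not be
    an ordered idempotent; symmetrically for [e * a] and [a * x]. *)
Lemma idempotent_multiples_clifford :
  (forall e, ordered_idempotent e ->
     down_closure (rmultiples e) = down_closure (lmultiples e)) ->
  clifford S.
Proof.
move=> rl; split=> // a e eI.
have l2r f t : ordered_idempotent f -> exists s, (t * f <= f * s)%O.
  move=> fI; apply/down_rmultiplesP; rewrite rl //.
  by apply/down_lmultiplesP; exists t.
have r2l f t : ordered_idempotent f -> exists s, (f * t <= s * f)%O.
  move=> fI; apply/down_lmultiplesP; rewrite -rl //.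
  by apply/down_rmultiplesP; exists t.
have [x ax] := regularP Sreg a.
have [u aeu] : exists u, (a * e <= e * u * a)%O.
  have [s aes] := l2r e a eI.
  have [r xaer] := r2l _ e (ordered_idempotent_mull _ _ ax).
  apply: (le_glue (r := a * r * x) aes).
  apply: Order.POrderTheory.le_trans (le_mulg2r e _ _ ax) _.
  by have := le_mulg2l a _ _ xaer; rewrite !mulgA.
have [v eav] : exists v, (e * a <= a * v * e)%O.
  have [s eas] := r2l e a eI.
  have [r eaxr] := l2r _ e (ordered_idempotent_mulr _ _ ax).
  apply: (le_glue (s := x * r * a) _ eas).
  apply: Order.POrderTheory.le_trans (le_mulg2l e _ _ ax) _.
  by have := le_mulg2r a _ _ eaxr; rewrite !mulgA.
by exists u, v.
Qed.

End RegularOrderedSemigroup.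

Theorem theorem5p2 (d : Order.disp_t) (S : orderedSemigroupType d)
    (Sreg : regular S) (Snozero : ~ has_zero S) :
  [<-> clifford S;
       @greenL d S = @greenR d S;
       forall a : S,
         down_closure (rmultiples a) = down_closure (lmultiples a);
       forall e : S, ordered_idempotent e ->
         down_closure (rmultiples e) = down_closure (lmultiples e)].
Proof.
tfae.
- by move=> Scl; apply: multiples_greenLR => //; exact: clifford_multiples.
- exact: greenLR_multiples.
- by move=> rl e _; exact: rl.
- exact: idempotent_multiples_clifford.
Qed.
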